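(* Let $k$ be a fixed positive integer. For each positive integer $n$, let $b_k(n)$ denote the number of $2k \times 2n$ matrices with entries in $\{0,1\}$ such that every row contains exactly $n$ ones (and hence exactly $n$ zeroes) and every column contains exactly $k$ ones (and hence exactly $k$ zeroes). Then the sequence $\{b_k(n)\}_{n=1}^{\infty}$ is holonomic (P-recursive): there exist a positive integer $L$ and polynomials $p_0(n), \dots, p_L(n)$ in $n$, with $p_L(n) \neq 0$, such that $$\sum_{i=0}^{L} p_i(n)\, b_k(n+i) = 0$$ for all positive integers $n$.
   Context: A $0$-$1$ matrix is called balanced if every row and every column contains as many zeroes as ones. *)

(* Defs.v *)
From HB Require Import structures.
From mathcomp Require Import all_boot all_order all_algebra.

Set Implicit Arguments.
Unset Strict Implicit.
Unset Printing Implicit Defensive.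

Import GRing.Theory.
Local Open Scope ring_scope.

(* A 0-1 matrix is a matrix of booleans, [true] standing for 1. *)
Definition balanced (k n : nat) (A : 'M[bool]_(2 * k, 2 * n)) : bool :=
  [forall i, #|[set j | A i j]| == n] && [forall j, #|[set i | A i j]| == k].

Definition b (k n : nat) : nat :=
  #|[set A : 'M[bool]_(2 * k, 2 * n) | balanced A]|.

(* Sequences are indexed by the positive integers: the value [u 0] is never
   used. *)
Definition holonomic (u : nat -> rat) : Prop :=
  exists2 L : nat, (0 < L)%N &
  exists2 p : 'I_L.+1 -> {poly rat}, p ord_max != 0 &
    forall n : nat, (0 < n)%N ->
      \sum_(i < L.+1) (p i).[n%:R] * u (n + i)%N = 0.

(* Main.v *)
(* Let P be the Laurent polynomial that is the sum of the monomials x^s over the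
   allowed columns s; [walks N v] is the coefficient of x^v in P^N, and
   b k n is the coefficient of x^(n,...,n) in P^(2n), i.e. the residue of
   G_n = P^(2n) x^(-n-1).  The derivatives of order B of G_(n+D+b), for b and all
   B_i at most d, are (d+1)^(m+1) in number (m = 2k variables), and over Q(n) they all lie in a space
   of dimension O(d^m) (a common power of P times Laurent polynomials of degree
   O(d)).  Hence for d large there is a nontrivial relation with coefficients
   A_(b,B) depending on n only, not on x.  Multiplying it by x^C, where C is a
   minimal B occurring in it, and taking residues (integration by parts) kills
   every term but those with B = C, which leaves
   C! sum_b A_(b,C)(n) b_k(n+D+b) = 0 up to sign. *)
Require Import Defs.
From mathcomp Require Import all_boot all_order all_algebra.
From mathcomp Require Import zify ring generic_quotient.

Set Implicit Arguments.
Unset Strict Implicit.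
Unset Printing Implicit Defensive.

Import Order.TTheory GRing.Theory Num.Theory.
Local Open Scope ring_scope.

(** * Coefficients of powers of a Laurent polynomial *)

Fixpoint walks (I : finType) (steps : seq {ffun I -> int}) (N : nat)
    (v : {ffun I -> int}) : rat :=
  if N is N'.+1 then \sum_(s <- steps) walks steps N' (v - s)
  else (v == 0)%:R.

Lemma walksS (I : finType) (steps : seq {ffun I -> int}) N v :
  walks steps N.+1 v = \sum_(s <- steps) walks steps N (v - s).
Proof. by []. Qed.

(* The Euler operator x_i d/dx_i applied to P^(N+1). *)
Lemma mulr_walks (I : finType) (steps : seq {ffun I -> int}) (i : I) N
    (v : {ffun I -> int}) :
  (v i)%:~R * walks steps N.+1 v =
  N.+1%:R * \sum_(s <- steps) (s i)%:~R * walks steps N (v - s).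
Proof.
elim: N v => [|N IHN] v.
  rewrite mul1r /= mulr_sumr; apply: eq_bigr => s _.
  by rewrite subr_eq0; case: eqP => [->|_] //; rewrite !mulr0.
(* Write v_i as s_i + (v - s)_i; the induction hypothesis handles the second summand. *)
have split_v s : (v i)%:~R * walks steps N.+1 (v - s) =
    (s i)%:~R * walks steps N.+1 (v - s) +
    N.+1%:R * \sum_(s' <- steps) (s' i)%:~R * walks steps N (v - s - s').
  by rewrite -IHN -mulrDl -rmorphD /= !ffunE subrKC.
rewrite walksS [LHS]mulr_sumr; under eq_bigr do rewrite split_v.
rewrite big_split /= -mulr_sumr exchange_big /=.
rewrite -[N.+2%:R]natr1 mulrDl mul1r addrC; congr (_ * _ + _).
apply: eq_bigr => s _; rewrite -mulr_sumr; congr (_ * _).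
by apply: eq_bigr => s' _; rewrite addrAC.
Qed.

(** * Expansions in boundedly many translates *)

Definition in_box (I : finType) (R : nat) (v : {ffun I -> int}) : bool :=
  [forall i, absz (v i) <= R]%N.

Lemma in_boxP (I : finType) R (v : {ffun I -> int}) :
  reflect (forall i, absz (v i) <= R)%N (in_box R v).
Proof. exact: forallP. Qed.

(* [f] is a combination, with coefficients polynomial in [n], of the translates
   of [walks] by vectors of norm at most [R], at the fixed length offset [e]:
   this plays the role of the space of functions P^(rn+e) x^(-nu) Q, where Q is
   a Laurent polynomial of degree at most R. *)
Definition expands (I : finType) (steps : seq {ffun I -> int}) (r : nat)
    (u : {ffun I -> int}) (e R : nat) (f : nat -> {ffun I -> int} -> rat) :=
  exists2 q : seq ({poly rat} * {ffun I -> int}),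
    {in q, forall x, in_box R x.2} &
    forall n t, f n t =
      \sum_(x <- q) x.1.[n%:R] * walks steps (r * n + e) (t + u *+ n + x.2).

(** One factor of P is spent: [g] rewrites [phi] times a coefficient of P^(N+1) through coefficients
    of P^N. The translates move by one step, so the radius grows by [h]. It serves for [phi] = 1 and
    for [phi] = t_i + a. *)
Lemma expands_refine (I : finType) (steps : seq {ffun I -> int}) r u e R h
    (phi : {ffun I -> int} -> rat)
    (g : {ffun I -> int} -> {ffun I -> int} -> {poly rat}) f :
    {in steps, forall s, in_box h s} ->
    (forall n t d, phi t * walks steps (r * n + e).+1 (t + u *+ n + d) =
       \sum_(s <- steps) (g d s).[n%:R] * walks steps (r * n + e) (t + u *+ n + d - s)) ->
  expands steps r u e.+1 R f ->
  expands steps r u e (R + h) (fun n t => phi t * f n t).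
Proof.
move=> hsteps hphi [q hq hf].
exists [seq (x.1 * g x.2 s, x.2 - s) | x <- q, s <- steps].
  move=> _ /allpairsP [[x s] /= [/hq/in_boxP hx /hsteps/in_boxP hs ->]].
  apply/in_boxP=> i /=; rewrite !ffunE; move: (hx i) (hs i).
  by move: (x.2 i) (s i) => a b; lia.
move=> n t; rewrite hf mulr_sumr big_allpairs_dep /=; apply: eq_bigr => x _.
rewrite mulrCA addnS hphi mulr_sumr; apply: eq_bigr => s _.
by rewrite hornerM mulrA addrA.
Qed.

Lemma expands_step (I : finType) (steps : seq {ffun I -> int}) r u e R h f :
    {in steps, forall s, in_box h s} ->
  expands steps r u e.+1 R f -> expands steps r u e (R + h) f.
Proof.
move=> hsteps /(expands_refine (phi := fun=> 1) (g := fun _ _ => 1) hsteps).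
case=> [n t d|q hq hf].
  by rewrite mul1r; apply: eq_bigr => s _; rewrite hornerC mul1r.
by exists q => // n t; rewrite -hf mul1r.
Qed.

Lemma expands_mul (I : finType) (steps : seq {ffun I -> int}) r u e R h f i (a : rat) :
    {in steps, forall s, in_box h s} ->
  expands steps r u e.+1 R f ->
  expands steps r u e (R + h) (fun n t => ((t i)%:~R + a) * f n t).
Proof.
move=> hsteps.
(* With v = t + nu + d one has t_i + a = v_i - n u_i - d_i + a, and [mulr_walks] trades v_i for (rn
   + e + 1) s_i; this gives [g], of degree at most 1 in n. *)
apply: (expands_refine (phi := fun t : {ffun I -> int} => (t i)%:~R + a)
  (g := fun d s => (r%:R * (s i)%:~R - (u i)%:~R) *: 'X
     + (e.+1%:R * (s i)%:~R - (d i)%:~R + a)%:P) hsteps) => n t d.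
have -> : (t i)%:~R + a = ((t + u *+ n + d) i)%:~R
    + (a - (d i)%:~R - (u i)%:~R * n%:R) :> rat.
  by rewrite !ffunE ffunMnE !rmorphD /= rmorphMn /= -mulr_natr; ring.
rewrite mulrDl mulr_walks /= !mulr_sumr -big_split /=.
apply: eq_bigr => s _; rewrite mulrA -mulrDl; congr (_ * _).
by rewrite !hornerE -addnS natrD natrM /=; ring.
Qed.

Lemma expands_walks (I : finType) (steps : seq {ffun I -> int}) r u e R d :
  in_box R d ->
  expands steps r u e R (fun n t => walks steps (r * n + e) (t + u *+ n + d)).
Proof.
move=> hd; exists [:: (1, d)] => [x|n t]; first by rewrite inE => /eqP->.
by rewrite big_seq1 hornerC mul1r.
Qed.

Lemma expands_steps (I : finType) (steps : seq {ffun I -> int}) r u e k R h f :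
    {in steps, forall s, in_box h s} ->
  expands steps r u (k + e) R f -> expands steps r u e (R + h * k) f.
Proof.
move=> hsteps; elim: k R => [|k IHk] R; first by rewrite muln0 addn0.
by rewrite mulnS addnA => /(expands_step hsteps)/IHk.
Qed.

Lemma expands_prod (I : finType) (steps : seq {ffun I -> int}) r u e R h f
    (l : seq (I * nat)) :
    {in steps, forall s, in_box h s} ->
  expands steps r u (size l + e) R f ->
  expands steps r u e (R + h * size l)
    (fun n t => \prod_(x <- l) ((t x.1)%:~R + x.2%:R) * f n t).
Proof.
move=> hsteps; elim: l e => [|x l IHl] e /=.
  rewrite muln0 addn0 => -[q hq hf].
  by exists q => // n t; rewrite big_nil mul1r.
rewrite addSn -addnS => /IHl/(expands_mul x.1 x.2%:R hsteps).
rewrite mulnSr addnA; case=> q hq hf; exists q => // n t.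
by rewrite big_cons -mulrA.
Qed.

(** Indexes the box of radius [R] by a finite type with (2R+1)^|I| elements, for the dimension
    count. *)
Definition of_box (I : finType) (R : nat)
    (y : {ffun I -> 'I_(2 * R).+1}) : {ffun I -> int} :=
  [ffun i => (y i)%:Z - R%:Z].

Lemma expands_of_box (I : finType) (steps : seq {ffun I -> int}) r u R f :
    expands steps r u 0 R f ->
  exists M : {ffun {ffun I -> 'I_(2 * R).+1} -> {poly rat}}, forall n t,
    f n t = \sum_y (M y).[n%:R] * walks steps (r * n) (t + u *+ n + of_box y).
Proof.
case=> q hq hf; exists [ffun y => \sum_(x <- q | x.2 == of_box y) x.1] => n t.
rewrite hf.
under [RHS]eq_bigr do rewrite ffunE horner_sum mulr_suml big_mkcond.
rewrite exchange_big /= big_seq [RHS]big_seq; apply: eq_bigr => x /hq/in_boxP hx.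
pose y0 : {ffun I -> 'I_(2 * R).+1} := [ffun i => inord (absz (x.2 i + R%:Z))].
have y0E : of_box y0 = x.2.
  apply/ffunP => i; rewrite !ffunE; move: (hx i); move: (x.2 i) => a ha.
  by rewrite inordK; lia.
rewrite (bigD1 y0) //= y0E eqxx addn0 big1 ?addr0 // => y yNy0.
case: eqP => // xE; case/eqP: yNy0; apply/ffunP => i.
by rewrite !ffunE xE ffunE subrK /= inord_val.
Qed.

(** * Linear relations over a domain, and tools for extracting a recurrence *)

Lemma fraction_denom (R : idomainType) (x : {fraction R}) :
  exists2 d : R, d != 0 & exists a : R, FracField.tofrac d * x = FracField.tofrac a.
Proof.
elim/quotW: x => x; exists x.2; first exact: denom_ratioP.
exists x.1; unlock FracField.tofrac.
rewrite -[LHS]FracField.pi_mul; apply/eqmodP.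
rewrite /= FracField.equivfE /FracField.mulf.
have x2 := denom_ratioP x.
by rewrite !numden_Ratio ?mulf_neq0 ?oner_neq0 ?mul1r ?mulr1.
Qed.

(** The rank over the fraction field is at most n < m, so the left kernel is nonzero; clearing
    denominators brings a kernel vector back to [R]. *)
Lemma left_kernel_neq0 (R : idomainType) (m n : nat) (M : 'M[R]_(m, n)) :
  (n < m)%N -> exists2 w : 'rV[R]_m, w != 0 & w *m M = 0.
Proof.
move=> ltnm; pose MF := map_mx (@FracField.tofrac R) M.
have : kermx MF != 0.
  rewrite kermx_eq0 -row_leq_rank -ltnNge; apply: leq_ltn_trans ltnm.
  exact: rank_leq_col.
case/rowV0Pn=> v /sub_kermxP vM v0.
have [D D0 Dv] : exists2 D : R, D != 0 & forall i, exists a,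
    FracField.tofrac D * v 0 i = FracField.tofrac a.
  have /fin_all_exists2[d d0 hd] i := fraction_denom (v 0 i).
  exists (\prod_i d i); first by apply/prodf_neq0.
  move=> i; have [a ha] := hd i; exists (\prod_(j | j != i) d j * a).
  by rewrite (bigD1 i) //= mulrC !rmorphM /= mulrCA -ha mulrA mulrC.
have /fin_all_exists[w hw] := Dv.
have wE : map_mx (@FracField.tofrac R) (\row_i w i) = FracField.tofrac D *: v.
  by apply/rowP => i; rewrite !mxE -hw.
have tofrac_inj : injective (@FracField.tofrac R).
  by move=> x y /eqP; rewrite tofrac_eq => /eqP.
exists (\row_i w i).
  apply: contraNneq v0 => w0; move/eqP: wE.
  by rewrite w0 map_mx0 eq_sym scaler_eq0 tofrac_eq0 (negPf D0).
have : map_mx (@FracField.tofrac R) (\row_i w i *m M) = 0.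
  by rewrite map_mxM /= wE -scalemxAl vM scaler0.
move/matrixP=> wM; apply/matrixP => i j; apply: tofrac_inj.
by have := wM i j; rewrite !mxE rmorph0.
Qed.

(** The leading coefficient must be nonzero, so the sum is cut at the largest [L] with [p L]
    nonzero; [i0] forces [L] to be positive. *)
Lemma holonomic_recurrence (u : nat -> rat) (N i0 : nat) (p : nat -> {poly rat}) :
    (0 < i0 < N)%N -> p i0 != 0 ->
    (forall n, \sum_(i < N) (p i).[n%:R] * u (n + i)%N = 0) ->
  holonomic u.
Proof.
case/andP=> i0_gt0 i0N pi0 rec.
have exP : exists i, (i < N)%N && (p i != 0) by exists i0; rewrite i0N.
have ubP i : (i < N)%N && (p i != 0) -> (i <= N)%N by case/andP=> /ltnW.
case: (ex_maxnP exP ubP) => L /andP[LN pL] maxL.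
exists L; first by apply: leq_trans i0_gt0 (maxL _ _); rewrite i0N.
exists (fun i => p i) => // n _; rewrite -[RHS](rec n).
rewrite -!(big_mkord xpredT (fun i => (p i).[n%:R] * u (n + i)%N)).
rewrite [RHS](big_cat_nat _ (n := L.+1)) //= -[LHS]addr0; congr (_ + _).
rewrite big_nat big1 // => i /andP[Li iN]; case: (eqVneq (p i) 0) => [->|pi].
  by rewrite horner0 mul0r.
by have := maxL i; rewrite iN pi leqNgt Li => /(_ isT).
Qed.

(* The factors (i, j) of the product over i of the rising factorials
   t_i (t_i + 1) ... (t_i + B_i - 1). *)
Definition rising (I : finType) (d : nat) (B : {ffun I -> 'I_d}) : seq (I * nat) :=
  [seq (i, j) | i <- enum I, j <- iota 0 (B i)].

Lemma size_rising (I : finType) d (B : {ffun I -> 'I_d}) :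
  size (rising B) = (\sum_i B i)%N.
Proof.
rewrite size_allpairs_dep sumnE big_map -big_enum /=.
by apply: eq_bigr => i _; rewrite size_iota.
Qed.

(** A vanishing factor is some (i, C_i), and it occurs exactly when C_i < B_i. *)
Lemma rising_eq0 (I : finType) d (B C : {ffun I -> 'I_d}) :
  \prod_(x <- rising B) (- (C x.1)%:R + x.2%:R) = 0 :> rat <->
  ~ (forall i, B i <= C i)%N.
Proof.
split=> [/eqP|].
  rewrite prodf_seq_eq0 => /hasP[_ /allpairsPdep[i [j [_ jB ->]]] /=].
  rewrite addrC subr_eq0 eqr_nat => /eqP jC /(_ i).
  by move: jB; rewrite mem_iota jC add0n => /andP[_]; rewrite ltnNge => /negP.
move=> BC; apply/eqP; rewrite prodf_seq_eq0; apply/hasP.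
have /forallPn[i] : ~~ [forall i, B i <= C i]%N by apply/forallP.
rewrite -ltnNge => CB; exists (i, nat_of_ord (C i)) => /=.
  by apply/allpairsPdep; exists i, (nat_of_ord (C i)); rewrite mem_enum mem_iota.
by rewrite addrC subrr.
Qed.

Lemma linear_relation (R : idomainType) (X Y : finType) (M : X -> Y -> R) :
  (#|Y| < #|X|)%N ->
  exists2 A : X -> R, exists x, A x != 0 &
    forall y, \sum_x A x * M x y = 0.
Proof.
move=> ltYX.
have [w w0 wM] := left_kernel_neq0
  (\matrix_(x < #|X|, y < #|Y|) M (enum_val x) (enum_val y)) ltYX.
exists (fun x => w 0 (enum_rank x)).
  have /rV0Pn[x wx] := w0; exists (enum_val x).
  by rewrite enum_valK.
move=> y; move/matrixP: wM => /(_ 0 (enum_rank y)); rewrite !mxE => wMy.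
rewrite -[RHS]wMy.
rewrite (reindex _ (onW_bij _ (enum_val_bij X))) /=; apply: eq_bigr => x _.
by rewrite mxE enum_valK enum_rankK.
Qed.

(** * Recurrence for the coefficients along a ray *)

Theorem holonomic_walks (I : finType) (steps : seq {ffun I -> int}) (r : nat)
    (u : {ffun I -> int}) :
  (0 < r)%N -> holonomic (fun n => walks steps (r * n) (u *+ n)).
Proof.
move=> r_gt0.
pose h := (\max_(s <- steps) \max_i absz (s i))%N.
have hsteps : {in steps, forall s, in_box h s}.
  move=> s sin; apply/in_boxP => i; apply: leq_trans (leq_bigmax_seq _ sin isT).
  exact: (leq_bigmax (F := fun i => absz (s i))).
pose U := (\max_i absz (u i))%N.
have hU i : (absz (u i) <= U)%N by exact: (leq_bigmax (F := fun i => absz (u i))).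
pose m := #|I|.
(* [K] is independent of [d], and R = K(d+1) bounds every translate needed below. The choice of [d]
   gives (2R+1)^m <= d (d+1)^m < (d+1)^(m+1). As D > md, the exponent r(D+b) has room for all the
   rising factors. *)
pose K := (m.+1 * (U + h * r)).+1.
pose d := ((2 * K).+1 ^ m)%N.
pose R := (K * d.+1)%N.
pose D := (m * d).+1.
pose shift (B : {ffun I -> 'I_d.+1}) : {ffun I -> int} := [ffun i => (B i)%:Z].
(* [T (b, B) n] lists, up to an index shift, the coefficients of the derivative
   of order [B] of G_(n+D+b). *)
pose T (x : 'I_d.+1 * {ffun I -> 'I_d.+1}) n (t : {ffun I -> int}) : rat :=
  \prod_(y <- rising x.2) ((t y.1)%:~R + y.2%:R) *
  walks steps (r * n + r * (D + x.1)) (t + u *+ n + (u *+ (D + x.1) + shift x.2)).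
have hT x : expands steps r u 0 R (T x).
  have xD : (D + x.1 <= m.+1 * d.+1)%N.
    by rewrite /D; have := ltn_ord x.1; nia.
  have size_le : (size (rising x.2) <= r * (D + x.1))%N.
    rewrite size_rising; apply: (@leq_trans (m * d)%N); last first.
      by rewrite (leq_trans _ (leq_pmull _ r_gt0)) // /D; lia.
    rewrite -sum_nat_const; apply: leq_sum => i _.
    by rewrite -ltnS.
  have RE : (U * (D + x.1) + d + h * (r * (D + x.1)) <= R)%N.
    rewrite /R /K mulSn addnAC -(leq_add2r 1%N) mulnA -mulnDl.
    have : ((U + h * r) * (D + x.1) <= (U + h * r) * (m.+1 * d.+1))%N.
      by rewrite leq_mul2l xD orbT.
    by lia.
  pose l := size (rising x.2).
  (* Of the r(D+b) spare factors of P, [l] absorb the rising factors and the others are expanded by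
     the plain recursion; each costs [h] in radius. *)
  have -> : R = (R - h * (r * (D + x.1)) + h * (r * (D + x.1) - l) + h * l)%N.
    by rewrite -addnA -mulnDr subnK // subnK //; lia.
  apply: (expands_prod hsteps); rewrite addn0.
  apply: (expands_steps hsteps); rewrite subnK //.
  apply: expands_walks; apply/in_boxP => i; rewrite !ffunE ffunMnE.
  apply: (@leq_trans (U * (D + x.1) + d)); last by lia.
  have := ltn_ord (x.2 i); have := hU i.
  move: (x.2 i : nat) (u i) (D + x.1)%N => b c e; rewrite -mulr_natr.
  by nia.
have /fin_all_exists[M hM] x := expands_of_box (hT x).
have cardYX : (#|{ffun I -> 'I_(2 * R).+1}| < #|{: 'I_d.+1 * {ffun I -> 'I_d.+1}}|)%N.
  rewrite card_prod !card_ffun !card_ord -/m.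
  apply: (@leq_ltn_trans (((2 * K).+1 * d.+1) ^ m)).
    have leR : ((2 * R).+1 <= (2 * K).+1 * d.+1)%N by rewrite /R; nia.
    by case: (posnP m) => [->|m_gt0] //; rewrite leq_exp2r.
  by rewrite expnMn ltn_pmul2r ?expn_gt0.
have [A [x0 Ax0] AM] := linear_relation M cardYX.
have rel n t : \sum_x (A x).[n%:R] * T x n t = 0.
  under eq_bigr do rewrite hM mulr_sumr.
  rewrite exchange_big big1 // => y _.
  have := congr1 (fun p => p.[n%:R] * walks steps (r * n) (t + u *+ n + of_box y)) (AM y).
  rewrite /= horner0 mul0r => My; rewrite -[RHS]My horner_sum mulr_suml.
  by apply: eq_bigr => x _; rewrite hornerM mulrA.
pose P (B : {ffun I -> 'I_d.+1}) := [exists b, A (b, B) != 0].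
have Px0 : P x0.2 by apply/existsP; exists x0.1; case: (x0) Ax0.
case: (arg_minnP (fun B : {ffun I -> 'I_d.+1} => (\sum_i B i)%N) Px0).
move=> C /existsP[b0 Ab0] minC.
(* At t = - shift C the term T (b, B) vanishes unless B <= C, and by minimality
   of C the only B <= C with a nonzero coefficient is C itself. *)
pose kappa : rat := \prod_(x <- rising C) (- (C x.1)%:R + x.2%:R).
have kappa0 : kappa != 0 by apply/eqP => /rising_eq0; apply.
(* The relation involves only the shifts D+b, so lower ones are padded with 0; D > 0 makes the index
   D+b0 positive. *)
pose p i := if (i < D)%N then 0 else A (inord (i - D), C).
apply: (@holonomic_recurrence _ (D + d.+1) (D + b0) p).
- by rewrite ltn_add2l ltn_ord andbT.
- by rewrite /p ltnNge leq_addr addKn inord_val.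
move=> n; apply: (mulfI kappa0); rewrite mulr0 -[RHS](rel n (- shift C)).
rewrite big_split_ord /= big1 => [|i _]; last first.
  by rewrite /p ltn_ord horner0 mul0r.
pose S b B := (A (b, B)).[n%:R] * T (b, B) n (- shift C).
rewrite add0r mulr_sumr [RHS](eq_bigr (fun x => S x.1 x.2)) => [|[] //].
rewrite -(pair_bigA _ S) /S.
apply: eq_bigr => b _; rewrite (bigD1 C) //= big1 ?addr0 => [|B BC].
  rewrite /p ltnNge leq_addr addKn inord_val mulrCA; congr (_ * _).
  rewrite /T /= /kappa; congr (_ * _).
    by apply: eq_bigr => x _; rewrite !ffunE rmorphN.
  (* At t = - shift C the translate [shift C] cancels, leaving u *+ (n + D + b). *)
  by rewrite mulnDr [in RHS]addrC addrA addrK -mulrnDr (addnC n).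
have [->|AbB] := eqVneq (A (b, B)) 0; first by rewrite horner0 mul0r.
rewrite /T (_ : \prod_(y <- _) _ = 0) ?mul0r ?mulr0 //.
rewrite -[RHS](_ : \prod_(x <- rising B) (- (C x.1)%:R + x.2%:R) = 0).
  by apply: eq_bigr => x _; rewrite !ffunE rmorphN.
apply/rising_eq0 => leBC.
have : (\sum_i C i <= \sum_i B i)%N.
  by apply: minC; apply/existsP; exists b.
have [leBCsum eqBCsum] : (\sum_i B i <= \sum_i C i
    ?= iff [forall i, B i == C i :> nat])%N.
  by apply: leqif_sum => i _; apply: leqif_eq.
move=> leCB; move: eqBCsum; rewrite eqn_leq leBCsum leCB => /esym/forallP eqBC.
by case/eqP: BC; apply/ffunP => i; apply: val_inj; apply/eqP/eqBC.
Qed.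

(** * Balanced matrices as walks *)

Definition indicator (m : nat) (w : 'cV[bool]_m) : {ffun 'I_m -> int} :=
  [ffun i => (w i 0)%:Z].

(** The exponents of the k-th elementary symmetric polynomial in m variables, which is P here. *)
Definition column_steps (m k : nat) : seq {ffun 'I_m -> int} :=
  [seq indicator w | w <- enum [pred w : 'cV[bool]_m | #|[set i | w i 0]| == k]].

Lemma card_set_sum (I : finType) (P : pred I) : #|[set i | P i]| = (\sum_i P i)%N.
Proof. by rewrite -sum1dep_card big_mkcond. Qed.

(** Induction on the number of columns: removing the first column subtracts its indicator from the
    prescribed row sums. *)
Lemma walks_columns (m k N : nat) (v : {ffun 'I_m -> int}) :
  walks (column_steps m k) N v =
  #|[set A : 'M[bool]_(m, N) |
      [forall i, (#|[set j | A i j]|%:Z == v i)] &&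
      [forall j, #|[set i | A i j]| == k]]|%:R.
Proof.
rewrite card_set_sum natr_sum; elim: N v => [|N IHN] v.
  rewrite (big_pred1 (const_mx false)) => [|A] /=; last first.
    by apply/esym/eqP/matrixP => i [].
  congr (nat_of_bool _)%:R; rewrite [X in _ && X](_ : _ = true) ?andbT; last first.
    by apply/forallP => -[].
  apply/eqP/forallP => [-> i|v0]; first by rewrite card_set_sum big_ord0 ffunE.
  by apply/ffunP => i; rewrite -(eqP (v0 i)) card_set_sum big_ord0 ffunE.
rewrite walksS big_map big_enum_cond /=.
under eq_bigr do rewrite IHN.
rewrite pair_big /= big_mkcond.
rewrite [RHS](reindex (fun p : 'cV[bool]_m * 'M[bool]_(m, N) =>
  row_mx p.1 p.2 : 'M_(m, 1 + N))) /=; last first.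
  exists (fun A : 'M_(m, 1 + N) => (lsubmx A, rsubmx A)) => [[w A]|A] _ /=.
    by rewrite row_mxKl row_mxKr.
  by rewrite hsubmxK.
apply: eq_bigr => -[w A] _ /=; rewrite inE !andbT.
have rowE i : (#|[set j | row_mx w A i j]|%:Z == v i) =
    (#|[set j | A i j]|%:Z == (v - indicator w) i).
  rewrite !card_set_sum (@big_split_ord _ _ _ 1 N) big_ord1 /= row_mxEl.
  under eq_bigr do rewrite row_mxEr.
  by rewrite PoszD !ffunE eq_sym addrC -subr_eq eq_sym.
have colE : [forall j, #|[set i | row_mx w A i j]| == k] =
    (#|[set i | w i 0]| == k) && [forall j, #|[set i | A i j]| == k].
  have colL : #|[set i | row_mx w A i (lshift N 0)]| = #|[set i | w i 0]|.
    by apply: eq_card => i; rewrite !inE row_mxEl.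
  have colR j : #|[set i | row_mx w A i (rshift 1 j)]| = #|[set i | A i j]|.
    by apply: eq_card => i; rewrite !inE row_mxEr.
  apply/forallP/andP => [cols|[colw /forallP colsA] j].
    rewrite -colL cols; split=> //; apply/forallP => j.
    by rewrite -colR cols.
  case: (@split_ordP 1 N j) => j' ->; last by rewrite colR colsA.
  by rewrite ord1 colL.
rewrite (eq_forallb rowE) colE andbCA.
by case: (_ == k).
Qed.

Theorem theorem1 (k : nat) (hk : (0 < k)%N) :
  holonomic (fun n : nat => (b k n)%:R).
Proof.
(* [ltn0Sn 1] fixes r = 2: there are 2n columns, and all row sums equal n. *)
have [L L0 [p pL rec]] := holonomic_walks (column_steps (2 * k) k) [ffun=> 1] (ltn0Sn 1).
exists L => //; exists p => // n n0; rewrite -[RHS](rec n n0).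
apply: eq_bigr => i _; congr (_ * _); rewrite walks_columns /b; congr _%:R.
apply: eq_card => A; rewrite !inE /balanced; congr (_ && _).
by apply: eq_forallb => j; rewrite ffunMnE ffunE; lia.
Qed.
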